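(* Let $G\in\mathbb{R}^{n\times n}$ with $\rho(G)<1$, let $z\in\mathbb{R}^n$, let $x\in\mathbb{R}^n$ be the solution of $x=Gx+z$, and fix $i\in\{1,\dots,n\}$. Run the synchronous algorithm: $\hat{x}_i^{(0)}=0$, $r^{(0)}=e_i$, and for $t\ge 0$, $\hat{x}_i^{(t+1)}=\hat{x}_i^{(t)}+z^Tr^{(t)}$ and $r^{(t+1)}=G^Tr^{(t)}$. Then $\hat{x}_i^{(t)}\to x_i$ as $t\to\infty$, and for every $t\ge 0$, $$|\hat{x}_i^{(t)}-x_i| = |r^{(t)T}x| \le \|G\|_2^t\,\|x\|_2 .$$ Moreover, the total number of update tasks performed in the first $t$ iterations is $O\big(\sum_{k=0}^{t-1}|N_i(k)|\big)=O\big(\min(d^t,\,nt)\big)$.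
   Context: $e_i$ is the $i$-th standard basis vector, $\rho(\cdot)$ is the spectral radius and $\|\cdot\|_2$ the Euclidean norm / induced operator 2-norm. The directed graph $\mathcal{G}(G)$ has vertex set $\{1,\dots,n\}$ and an edge $(u,v)$ iff $G_{uv}\neq 0$. $N_u=\{v: G_{uv}\ne 0\}$, $d=\max_u|N_u|$ (every row of $G$ has at most $d$ nonzero entries), and $N_i(k)$ is the set of nodes $v$ such that there is a directed path from $i$ to $v$ in $\mathcal{G}(G)$ of length at most $k$ (so $N_i(0)=\{i\}$). In the synchronous implementation, iteration $k$ (computing $r^{(k+1)}$ and $\hat{x}_i^{(k+1)}$ from $r^{(k)}$, whose support lies in $N_i(k)$) is split into one coordinate-update task for each coordinate $u\in N_i(k)$: the task for $u$ adds $G_{uv}r^{(k)}_u$ to $r^{(k+1)}_v$ for each $v$ with $G_{uv}\ne 0$ and adds $z_ur^{(k)}_u$ to the estimate; a task for $u$ uses $O(|N_u|)$ accesses.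
   Formalization: The bound O(min(d^t, nt)) is stated only for d ≥ 2, since it fails for d ≤ 1 (for G = ½I, d = 1 and the sum is t while min(d^t, nt) = 1); the bound O(nt) is stated for every d. *)

(* Defs.v *)
From HB Require Import structures.
From mathcomp Require Import all_boot all_order all_algebra.
From mathcomp Require Import complex.
From mathcomp Require Import all_classical all_reals all_analysis.

Set Implicit Arguments.
Unset Strict Implicit.
Unset Printing Implicit Defensive.
Import Order.TTheory GRing.Theory Num.Theory.
Import numFieldNormedType.Exports.
Local Open Scope ring_scope.

Section Norms.
Variable R : realType.

(* The eigenvalues are the complex ones. *)
Definition spectral_radius n (A : 'M[R]_n) : R :=
  sup [set ComplexField.Normc.normc l
      | l in [set l : R[i] | eigenvalue (map_mx (real_complex R) A) l]]%classic.

(* The norm the library puts on matrices is the sup norm of the entries, hence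
   the two definitions below. *)
Definition norm2 n (v : 'cV[R]_n) : R := Num.sqrt (\sum_j v j 0 ^+ 2).

Definition opnorm2 m n (A : 'M[R]_(m, n)) : R :=
  sup [set norm2 (A *m v) | v in [set v : 'cV[R]_n | norm2 v <= 1]]%classic.

End Norms.

Section Graph.
Variables (R : realType) (n : nat) (G : 'M[R]_n).

Definition edge : rel 'I_n := fun u v => G u v != 0.

Definition out_nbrs (u : 'I_n) : {set 'I_n} := [set v | edge u v].

Definition max_deg : nat := \max_(u < n) #|out_nbrs u|.

(* A path from i is [i :: p]; its length is the number of edges, size p. *)
Definition reach (i : 'I_n) (k : nat) : {set 'I_n} :=
  [set v | [exists l : 'I_k.+1, [exists p : l.-tuple 'I_n,
     path edge i p && (last i p == v)]]].

End Graph.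

Section Algorithm.
Variables (R : realType) (n : nat) (G : 'M[R]_n) (z : 'cV[R]_n) (i : 'I_n).

Fixpoint residual (t : nat) : 'cV[R]_n :=
  if t is t'.+1 then G^T *m residual t' else delta_mx i 0.

Fixpoint estimate (t : nat) : R :=
  if t is t'.+1 then estimate t' + (z^T *m residual t') 0 0 else 0.

(* The implementation by coordinate-update tasks, with a counter [ntasks] of
   the tasks performed so far. *)
Record impl_state := ImplState { est : R; res : 'cV[R]_n; ntasks : nat }.

(* [r] is the residual at the start of the current iteration; [res s] is the
   part of the next residual accumulated so far. *)
Definition update_task (r : 'cV[R]_n) (s : impl_state) (u : 'I_n) :=
  ImplState (est s + z u 0 * r u 0)
            (\col_v (if v \in out_nbrs G u then res s v 0 + G u v * r u 0
                     else res s v 0))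
            (ntasks s).+1.

Definition sync_iteration (k : nat) (s : impl_state) : impl_state :=
  foldl (update_task (res s)) (ImplState (est s) 0 (ntasks s))
        (enum (reach G i k)).

Fixpoint sync_run (t : nat) : impl_state :=
  if t is t'.+1 then sync_iteration t' (sync_run t')
  else ImplState 0 (delta_mx i 0) 0.

Definition num_tasks (t : nat) : nat := ntasks (sync_run t).

Lemma residual_support t u : residual t u 0 != 0 -> u \in reach G i t.
Proof.
elim: t u => [|t IH] u /=.
  rewrite mxE eqxx andbT; have [-> _|_] := eqVneq u i; last by rewrite eqxx.
  rewrite inE; apply/existsP; exists ord0; apply/existsP.
  by exists [tuple]; rewrite /= eqxx.
rewrite mxE => /eqP nz.
have [w nzw] : exists w, G^T u w * residual t w 0 != 0.
  apply: contrapT => H; apply: nz; apply: big1 => w _.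
  by apply/eqP/negPn/negP => Hw; apply: H; exists w.
move: nzw; rewrite mxE mulf_eq0 negb_or => /andP[Gwu /IH].
rewrite !inE => /existsP[l /existsP[p /andP[pp /eqP lp]]].
apply/existsP; exists (lift ord0 l); apply/existsP.
have sz : size (rcons p u) == lift ord0 l by rewrite size_rcons size_tuple.
by exists (Tuple sz); rewrite /= rcons_path pp lp last_rcons eqxx andbT.
Qed.

Lemma foldl_update r s0 (s : seq 'I_n) :
  let s1 := foldl (update_task r) s0 s in
  est s1 = est s0 + \sum_(u <- s) z u 0 * r u 0
  /\ res s1 = res s0 + \col_v \sum_(u <- s) G u v * r u 0.
Proof.
elim: s s0 => [|u s IH] s0 /=.
  rewrite big_nil addr0; split=> //; apply/matrixP => v j.
  by rewrite !mxE big_nil addr0.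
have [-> ->] := IH (update_task r s0 u); split.
  by rewrite big_cons /= addrA.
apply/matrixP => v j; rewrite !mxE big_cons (ord1 j) inE /edge.
by case: eqP => [->|_] /=; rewrite ?mul0r ?add0r ?addrA.
Qed.

(* The tasks performed over the coordinates in [reach G i k] only do compute
   the matrix recursion. *)
Lemma sync_runE t :
  est (sync_run t) = estimate t /\ res (sync_run t) = residual t.
Proof.
elim: t => [//|t [IHe IHr]]; rewrite /= /sync_iteration.
have [-> ->] := foldl_update (res (sync_run t))
  (ImplState (est (sync_run t)) 0 (ntasks (sync_run t))) (enum (reach G i t)).
have sumE (f : 'I_n -> R) :
    \sum_(u <- enum (reach G i t)) f u * residual t u 0
    = \sum_u f u * residual t u 0.
  rewrite big_enum /= [RHS](bigID (mem (reach G i t))) /=.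
  rewrite [X in _ = _ + X]big1 ?addr0 // => u /negP nu.
  have -> : residual t u 0 = 0; last by rewrite mulr0.
  by apply/eqP/negPn/negP => /residual_support.
rewrite /= IHe IHr; split.
  by rewrite sumE mxE; congr (_ + _); apply: eq_bigr => u _; rewrite mxE.
apply/matrixP => v j; rewrite !mxE add0r sumE (ord1 j).
by apply: eq_bigr => u _; rewrite mxE.
Qed.

End Algorithm.

(* Main.v *)
Require Import Defs.
From mathcomp Require Import all_boot all_order all_algebra.
From mathcomp Require Import complex.
From mathcomp Require Import all_classical all_reals all_analysis.
From mathcomp Require Import lra zify.
Import Order.TTheory GRing.Theory Num.Theory.
Import numFieldNormedType.Exports.
Local Open Scope ring_scope.
Local Open Scope classical_set_scope.

(** The identity [estimate t + residual t ^T x = x_i] is an invariant of the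
    recursion, and [residual t ^T x] is the [i]-th coordinate of [G^t x], which
    gives the error formula and the norm bound.  That [G^t x] tends to [0] is
    obtained without Jordan or Schur forms: by Cayley-Hamilton, [x] is
    annihilated by a product of factors [G - l] with [l] an eigenvalue, and the
    factors are peeled off one at a time, since [|l| < 1] and
    [a (t+1) - l a t --> 0] force [a t --> 0].  For the task count,
    [|N_i (k+1)| <= 1 + d |N_i k|], whence [|N_i k| < 2 d^k] when [d > 1]. *)

(** * Euclidean and operator norms *)

Section EuclideanNorm.
Variable R : realType.

Lemma norm2_ge0 n (v : 'cV[R]_n) : 0 <= norm2 v.
Proof. exact: sqrtr_ge0. Qed.

Lemma ler_norm_norm2 n (v : 'cV[R]_n) i : `|v i 0| <= norm2 v.
Proof.
rewrite -sqrtr_sqr ler_wsqrtr // (bigD1 i) //= lerDl.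
by apply: sumr_ge0 => j _; exact: sqr_ge0.
Qed.

Lemma norm2Z n (a : R) (v : 'cV[R]_n) : 0 <= a -> norm2 (a *: v) = a * norm2 v.
Proof.
move=> a0; rewrite /norm2.
under eq_bigr do rewrite mxE exprMn.
by rewrite -mulr_sumr sqrtrM ?sqr_ge0 // sqrtr_sqr ger0_norm.
Qed.

Lemma norm2_eq0 n (v : 'cV[R]_n) : norm2 v = 0 -> v = 0.
Proof.
move=> v0; apply/matrixP => i j; rewrite (ord1 j) mxE; apply/eqP.
by rewrite -normr_le0 -v0 ler_norm_norm2.
Qed.

Lemma norm2_0 n : norm2 (0 : 'cV[R]_n) = 0.
Proof. by rewrite -(scale0r 0) norm2Z ?mul0r. Qed.

(** Needed because [sup] dominates its set only when that set is bounded above. Entries of [v] are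
    at most 1 in absolute value, so each coordinate of [A *m v] is at most the absolute row sum. *)
Lemma opnorm2_set_bounded m n (A : 'M[R]_(m, n)) :
  has_ubound [set norm2 (A *m v) | v in [set v : 'cV[R]_n | norm2 v <= 1]].
Proof.
exists (Num.sqrt (\sum_k (\sum_j `|A k j|) ^+ 2)) => _ [v /= v1 <-].
rewrite ler_wsqrtr // ler_sum // => k _.
rewrite -[leLHS]real_normK ?num_real // lerXn2r ?nnegrE ?sumr_ge0 //.
rewrite mxE (le_trans (ler_norm_sum _ _ _)) // ler_sum // => j _.
by rewrite normrM ler_piMr // (le_trans (ler_norm_norm2 _ v j)).
Qed.

Lemma opnorm2_ge0 m n (A : 'M[R]_(m, n)) : 0 <= opnorm2 A.
Proof.
apply: (ub_le_sup (opnorm2_set_bounded _ _ A)).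
by exists 0 => /=; rewrite ?mulmx0 norm2_0.
Qed.

Lemma norm2_mulmx m n (A : 'M[R]_(m, n)) v :
  norm2 (A *m v) <= opnorm2 A * norm2 v.
Proof.
have [/norm2_eq0 ->|v0] := eqVneq (norm2 v) 0.
  by rewrite mulmx0 !norm2_0 mulr0.
have vgt0 : 0 < norm2 v by rewrite lt_def v0 norm2_ge0.
(* Rescale [v] to norm 1, so that its image enters the supremum. *)
rewrite -ler_pdivrMr // mulrC -norm2Z ?invr_ge0 ?norm2_ge0 // scalemxAr.
apply: (ub_le_sup (opnorm2_set_bounded _ _ A)).
by exists ((norm2 v)^-1 *: v) => //=; rewrite norm2Z ?invr_ge0 ?norm2_ge0 ?mulVf.
Qed.

Lemma norm2_iter_mulmx n (A : 'M[R]_n) v t :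
  norm2 (iter t (mulmx A) v) <= opnorm2 A ^+ t * norm2 v.
Proof.
elim: t => [|t IH] /=; first by rewrite mul1r.
rewrite (le_trans (norm2_mulmx _ _ _ _)) // exprS -mulrA.
by rewrite ler_wpM2l // opnorm2_ge0.
Qed.

End EuclideanNorm.

(** * Decay of matrix powers *)

Section PowerConvergence.
Variable R : realType.
Local Notation normc := ComplexField.Normc.normc.

Lemma cvg0_affine_contraction (q : R) (a b : R^nat) :
    0 <= q < 1 -> (forall t, 0 <= a t) ->
    (forall t, a t.+1 <= q * a t + b t) ->
    b t @[t --> \oo] --> 0 ->
  a t @[t --> \oo] --> 0.
Proof.
move=> /andP[q0 q1] a0 rec b0; apply/cvgrPdist_le => e e0.
have e2 : 0 < e / 2 by rewrite divr_gt0.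
(* With this bound on [b], the map [y => q * y + e / 2 * (1 - q)] fixes [e / 2] and contracts
   towards it. *)
have d0 : 0 < e / 2 * (1 - q) by rewrite mulr_gt0 // subr_gt0.
have /cvgrPdist_le /(_ _ d0) [N _ bN] := b0.
have bound k : a (N + k)%N <= q ^+ k * a N + e / 2.
  elim: k => [|k IH]; first by rewrite addn0 mul1r lerDl ltW.
  rewrite addnS (le_trans (rec _)) // exprS.
  have /bN /= : (N <= N + k)%N by rewrite leq_addr.
  rewrite sub0r normrN => /ler_normlW bk.
  have := ler_wpM2l q0 IH; rewrite mulrDr mulrA; lra.
have : (fun k => q ^+ k * a N) @ \oo --> (0 : R).
  rewrite -(mul0r (a N)); apply: cvgMl; apply: cvg_expr.
  by rewrite ger0_norm.
move=> /cvgrPdist_le /(_ _ e2) [M _ aM].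
exists (N + M)%N => //= t /= Mt.
have -> : t = (N + (t - N))%N by lia.
have /aM /= : (M <= t - N)%N by lia.
rewrite !sub0r !normrN => /ler_normlW aN.
rewrite ger0_norm //; have := bound (t - N)%N; lra.
Qed.

Lemma normc_ge0 (c : R[i]) : 0 <= normc c.
Proof. by case: c => a b; exact: sqrtr_ge0. Qed.

Lemma normcD (c d : R[i]) : normc (c + d) <= normc c + normc d.
Proof. by rewrite -lecR rmorphD; exact: (ler_normD c d). Qed.

(** The moduli of the eigenvalues are bounded, since each eigenvalue is one of the finitely many
    roots of the characteristic polynomial; the sum of the root moduli serves as the bound. *)
Lemma eigenvalue_le_spectral_radius n (A : 'M[R]_n) (l : R[i]) :
  eigenvalue (map_mx (real_complex R) A) l -> normc l <= spectral_radius A.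
Proof.
move=> Al; apply: ub_le_sup; last by exists l.
set B := map_mx _ A in Al *.
have [r rP] := closed_field_poly_normal (char_poly B).
exists (\sum_(c <- r) normc c) => _ [c /= Bc <-].
have : c \in r.
  move: Bc; rewrite eigenvalue_root_char rP.
  by rewrite (monicP (char_poly_monic B)) scale1r root_prod_XsubC.
move=> cr; rewrite (big_rem c) //= lerDl.
by apply: sumr_ge0 => d _; exact: normc_ge0.
Qed.

Lemma iter_mulmx_cvg0 n (B : 'M[R[i]]_n.+1) (s : seq R[i])
    (v : 'cV_n.+1) i :
    {in s, forall l, normc l < 1} ->
    horner_mx B (\prod_(l <- s) ('X - l%:P)) *m v = 0 ->
  normc (iter t (mulmx B) v i 0) @[t --> \oo] --> (0 : R).
Proof.
elim: s v => [|l s IH] v s1.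
  rewrite big_nil rmorph1 mul1mx => ->.
  have it0 t : iter t (mulmx B) (0 : 'cV_n.+1) = 0.
    by elim: t => //= t ->; rewrite mulmx0.
  under eq_cvg do rewrite it0 mxE ComplexField.Normc.normc0.
  exact: cvg_cst.
(* Move the factor for [l] next to [v]: the vector [w = (B - l%:M) *m v] is then annihilated by the
   remaining factors, and the induction hypothesis applies to it. *)
rewrite big_cons mulrC rmorphM -mulmxA rmorphB /= horner_mx_X horner_mx_C.
move=> /IH cvgw.
have {}cvgw := cvgw (fun c cs => s1 c (mem_behead (s := l :: s) cs)).
have itw t : iter t (mulmx B) ((B - l%:M) *m v) =
    iter t.+1 (mulmx B) v - l *: iter t (mulmx B) v.
  elim: t => [|t /= ->]; first by rewrite mulmxBl mul_scalar_mx.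
  by rewrite mulmxBr scalemxAr.
(* The iterates satisfy [B^(t+1) v = l B^t v + B^t w], where the last term tends to 0. *)
apply: (cvg0_affine_contraction (normc l) _ _ _ _ _ cvgw).
- by rewrite s1 ?mem_head // andbT normc_ge0.
- by move=> t; exact: normc_ge0.
- move=> t; rewrite -ComplexField.Normc.normcM itw.
  move: (iter t _ _) (iter t.+1 _ _) => a b.
  have -> : b i 0 = l * a i 0 + (b - l *: a) i 0 by rewrite !mxE subrKC.
  exact: normcD.
Qed.

Lemma iter_mulmx_map n (A : 'M[R]_n) (x : 'cV[R]_n) t :
  iter t (mulmx (map_mx (real_complex R) A)) (map_mx (real_complex R) x) =
  map_mx (real_complex R) (iter t (mulmx A) x).
Proof. by elim: t => //= t ->; rewrite map_mxM. Qed.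

Lemma spectral_radius_lt1_cvg0 n (A : 'M[R]_n) (x : 'cV[R]_n) i :
  spectral_radius A < 1 -> iter t (mulmx A) x i 0 @[t --> \oo] --> (0 : R).
Proof.
(* Evaluating polynomials at a matrix needs a nonzero size; in size 0 there is no index [i]. *)
case: n A x i => [A x [] //|n A x i rho1].
set B := map_mx (real_complex R) A.
have [r rP] := closed_field_poly_normal (char_poly B).
rewrite (monicP (char_poly_monic B)) scale1r in rP.
apply/norm_cvg0P.
under eq_cvg => t.
  have -> : `|iter t (mulmx A) x i 0| =
      normc (iter t (mulmx B) (map_mx (real_complex R) x) i 0).
    by rewrite iter_mulmx_map mxE /= expr0n addr0 sqrtr_sqr.
  over.
apply: (iter_mulmx_cvg0 _ _ r); last by rewrite -rP Cayley_Hamilton mul0mx.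
move=> l lr; apply: le_lt_trans rho1; apply: eigenvalue_le_spectral_radius.
by rewrite eigenvalue_root_char rP root_prod_XsubC.
Qed.

End PowerConvergence.

(** * Error formula *)

Section Error.
Variables (R : realType) (n : nat) (G : 'M[R]_n) (z x : 'cV[R]_n) (i : 'I_n).

Lemma residual_mulmx t :
  ((residual G i t)^T *m x) 0 0 = iter t (mulmx G) x i 0.
Proof.
elim: t x => [|t IH] y.
  by rewrite /= trmx_delta -rowE mxE.
(* One factor [G] passes from the residual to the vector, hence the induction over all [y]. *)
by rewrite iterSr -IH /= trmx_mul trmxK mulmxA.
Qed.

(** Substituting the equation for [x] into [r^T x] gives [z^T r + (G^T r)^T x]: the increment of the
    estimate plus the next residual term. *)
Lemma estimate_invariant t : x = G *m x + z ->
  estimate G z i t + ((residual G i t)^T *m x) 0 0 = x i 0.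
Proof.
move=> xE; elim: t => [|t IH]; first by rewrite add0r residual_mulmx.
rewrite -[RHS]IH [in RHS]xE mulmxDr /= trmx_mul trmxK -mulmxA [in RHS]mxE.
rewrite -[X in z^T *m X]trmxK -trmx_mul [in X in _ + X + _]mxE.
by rewrite -addrA [X in _ + X]addrC.
Qed.

End Error.

(** * Counting update tasks *)

Section TaskCount.
Variables (R : realType) (n : nat) (G : 'M[R]_n) (z : 'cV[R]_n) (i : 'I_n).

Lemma ntasks_foldl r s0 (s : seq 'I_n) :
  ntasks (foldl (update_task G z r) s0 s) = (ntasks s0 + size s)%N.
Proof. by elim: s s0 => [|u s IH] s0 /=; rewrite ?addn0 // IH addSnnS. Qed.

Lemma num_tasksE t : num_tasks G z i t = (\sum_(0 <= k < t) #|reach G i k|)%N.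
Proof.
rewrite /num_tasks; elim: t => [|t IH]; first by rewrite big_geq.
by rewrite big_nat_recr //= -IH /sync_iteration ntasks_foldl /= -cardE.
Qed.

Lemma reachP k v :
  reflect (exists p, [/\ (size p <= k)%N, path (edge G) i p & last i p = v])
          (v \in reach G i k).
Proof.
rewrite inE; apply: (iffP existsP) => [[l /existsP[p /andP[pp /eqP <-]]]|].
  by exists p; rewrite size_tuple -ltnS.
move=> [p [pk pp <-]]; exists (Ordinal (pk : size p < k.+1)%N).
by apply/existsP; exists (in_tuple p); rewrite pp eqxx.
Qed.

Lemma reach0 : reach G i 0 = [set i]%SET.
Proof.
apply/finset.setP => v; rewrite finset.in_set1; apply/reachP/eqP => [[[|? ?] [// _ <-]] //|->].
by exists [::].
Qed.

(** Cut off the last edge of a path; the empty path accounts for [i] itself. *)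
Lemma reachS_sub k :
  reach G i k.+1 \subset (i |: \bigcup_(u in reach G i k) out_nbrs G u)%SET.
Proof.
apply/fintype.subsetP => v /reachP[p [pk pp <-]]; rewrite finset.in_setU1.
case/lastP: p pk pp => [|p w]; first by rewrite eqxx.
rewrite size_rcons rcons_path last_rcons => pk /andP[pp pw].
apply/orP; right; apply/finset.bigcupP; exists (last i p); last by rewrite inE.
by apply/reachP; exists p.
Qed.

Lemma card_reachS k : (#|reach G i k.+1| <= 1 + max_deg G * #|reach G i k|)%N.
Proof.
rewrite (leq_trans (subset_leq_card (reachS_sub k))) // cardsU1 leq_add ?leq_b1 //.
apply: leq_trans (unstable.card_big_setU _ _ _) _.
rewrite mulnC -sum_nat_const; apply: leq_sum => u _.
exact: (leq_bigmax (F := fun u => #|out_nbrs G u|)).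
Qed.

(** Strictness carries the induction: with [d = max_deg G],
    [1 + d (2 d^k - 1) = 2 d^(k+1) - (d - 1)], which is below [2 d^(k+1)] as [d > 1]. *)
Lemma card_reach_lt k :
  (1 < max_deg G)%N -> (#|reach G i k| < 2 * max_deg G ^ k)%N.
Proof.
move=> deg_gt1; elim: k => [|k IH]; first by rewrite reach0 cards1.
have := card_reachS k; rewrite expnS; nia.
Qed.

(** The degree condition cannot be dropped: each [reach G i k] contains [i], so the sum is at least
    [t], whereas [d^t <= 1] when [d <= 1]. *)
Lemma sum_card_reach_le t :
  (1 < max_deg G)%N ->
  (\sum_(0 <= k < t) #|reach G i k| <= 2 * max_deg G ^ t)%N.
Proof.
move=> deg_gt1; elim: t => [|t IH]; first by rewrite big_geq.
rewrite big_nat_recr //= expnS.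
apply: leq_trans (leq_add IH (ltnW (card_reach_lt t deg_gt1))) _.
(* The two summands are each at most [2 d^t], and doubling is absorbed by the extra factor
   [d >= 2]. *)
by rewrite addnn -mul2n leq_mul2l /= leq_mul2r deg_gt1 orbT.
Qed.

End TaskCount.

Theorem theorem1 (R : realType) :
  exists C : nat, forall (n : nat) (G : 'M[R]_n) (z x : 'cV[R]_n) (i : 'I_n),
    spectral_radius G < 1 ->
    x = G *m x + z ->
    [/\ estimate G z i t @[t --> \oo] --> x i 0,
        (forall t : nat,
           `|estimate G z i t - x i 0| = `|((residual G i t)^T *m x) 0 0| /\
           `|((residual G i t)^T *m x) 0 0| <= opnorm2 G ^+ t * norm2 x) &
        (forall t : nat,
           [/\ (num_tasks G z i t <= C * \sum_(0 <= k < t) #|reach G i k|)%N,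
               (\sum_(0 <= k < t) #|reach G i k| <= C * (n * t))%N &
               (1 < max_deg G)%N ->
               (\sum_(0 <= k < t) #|reach G i k|
                  <= C * minn (max_deg G ^ t) (n * t))%N])].
Proof.
(* The constant 2 comes from the bound [2 d^t]; the other two estimates hold with constant 1. *)
exists 2%N => n G z x i rho1 xE.
have estE t : estimate G z i t = x i 0 - iter t (mulmx G) x i 0.
  by rewrite -(estimate_invariant _ _ G z x i t xE) residual_mulmx addrK.
split=> [|t|t].
- rewrite (funext estE) -[X in _ `=>` nbhs X]subr0.
  by apply: cvgB; [exact: cvg_cst|exact: spectral_radius_lt1_cvg0].
- rewrite estE residual_mulmx addrC addKr normrN; split=> //.
  exact: le_trans (ler_norm_norm2 _ _ _ _) (norm2_iter_mulmx _ _ _ _ _).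
- have le_nt : (\sum_(0 <= k < t) #|reach G i k| <= n * t)%N.
    rewrite -[t in (n * t)%N]subn0 mulnC -sum_nat_const_nat.
    by apply: leq_sum => k _; rewrite -[n in (_ <= n)%N]card_ord max_card.
  split=> [||deg_gt1]; first by rewrite num_tasksE leq_pmull.
    by rewrite (leq_trans le_nt) ?leq_pmull.
  have := sum_card_reach_le _ _ G i t deg_gt1; lia.
Qed.
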